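(* Let $n\ge 2$ be a fixed integer and let $\mu_1,\mu_2,\ldots,\mu_n$ be fixed positive, mutually different real numbers. Suppose that $X_1,X_2,\ldots,X_n$ are independent copies of a non-negative random variable $X$ with density $f$. Assume that $X$ satisfies Cramér's condition: there is a number $t_0>0$ such that $\mathsf{E}[e^{-tX}]<\infty$ for all $t\in(-t_0,t_0)$. If the random variable $$S_n=\mu_1X_1+\mu_2X_2+\cdots+\mu_nX_n$$ has density $$g_n(x)=\sum_{j=1}^n \frac{\ell_j}{\mu_j}\,f\!\left(\frac{x}{\mu_j}\right),\qquad x\ge 0,\qquad\text{where}\quad \ell_j=\prod_{i=1,\,i\ne j}^n\frac{\mu_j}{\mu_j-\mu_i},\quad j=1,\ldots,n,$$ then $X\sim \mathrm{Exp}(\lambda)$ for some $\lambda>0$.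
   Context: $X\sim\mathrm{Exp}(\lambda)$ (with $\lambda>0$) means that $X$ has density $\lambda e^{-\lambda x}$ for $x\ge 0$ (and $0$ for $x<0$). ''Independent copies of $X$'' means independent random variables each with the same distribution as $X$. Densities are with respect to Lebesgue measure; as the variables are non-negative, their densities vanish on $x<0$ and are specified on $x\ge 0$. *)

(* Defs.v *)
From mathcomp Require Import all_boot all_order all_algebra.
From mathcomp Require Import all_classical all_reals all_analysis.

Set Implicit Arguments.
Unset Strict Implicit.
Unset Printing Implicit Defensive.

Import Order.TTheory GRing.Theory Num.Theory.
Import numFieldNormedType.Exports.

Local Open Scope classical_set_scope.
Local Open Scope ring_scope.

(* A density is determined only up to a Lebesgue-null set, so non-negativity is
   required almost everywhere: a signed combination such as [lin_comb_density]
   below may well be negative on a null set. *)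
Definition is_density d (T : measurableType d) (R : realType)
    (P : probability T R) (X : {RV P >-> R}) (f : R -> R) : Prop :=
  [/\ measurable_fun [set: R] f,
      {ae lebesgue_measure, forall x : R, 0 <= f x} &
      forall A : set R, measurable A ->
        distribution P X A = (\int[lebesgue_measure]_(x in A) (f x)%:E)%E].

Definition exponentially_distributed d (T : measurableType d) (R : realType)
    (P : probability T R) (X : {RV P >-> R}) (lambda : R) : Prop :=
  is_density X (exponential_pdf lambda).

Definition mutually_independent d (T : measurableType d) (R : realType)
    (P : probability T R) (I : finType) (Y : I -> {RV P >-> R}) : Prop :=
  forall (J : {set I}) (A : I -> set R), (forall i, measurable (A i)) ->
    P (\bigcap_(i in [set` J]) Y i @^-1` A i) =
      (\prod_(i in J) P (Y i @^-1` A i))%E.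

(* Equality of laws is tested on Borel sets only: on a non-measurable set the
   value of a measure is meaningless. *)
Definition independent_copies d (T : measurableType d) (R : realType)
    (P : probability T R) (X : {RV P >-> R})
    d' (T' : measurableType d') (P' : probability T' R)
    (I : finType) (Y : I -> {RV P' >-> R}) : Prop :=
  mutually_independent Y /\
  forall (i : I) (A : set R), measurable A ->
    distribution P' (Y i) A = distribution P X A.

Definition cramer_condition d (T : measurableType d) (R : realType)
    (P : probability T R) (X : {RV P >-> R}) : Prop :=
  exists2 t0 : R, 0 < t0 &
    forall t : R, - t0 < t < t0 ->
      ('E_P[fun w : T => expR (- t * X w)] < +oo)%E.

Definition lin_comb_RV d (T : measurableType d) (R : realType)
    (P : probability T R) (n : nat) (mu : 'I_n -> R)
    (Y : 'I_n -> {RV P >-> R}) : {RV P >-> R} :=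
  \sum_(i < n) mu i *: (Y i : {mfun T >-> R}).

Lemma lin_comb_RVE d (T : measurableType d) (R : realType)
    (P : probability T R) (n : nat) (mu : 'I_n -> R)
    (Y : 'I_n -> {RV P >-> R}) (w : T) :
  lin_comb_RV mu Y w = \sum_(i < n) mu i * Y i w.
Proof.
rewrite /lin_comb_RV.
by elim/big_ind2 : _ => // _ f _ g <- <-.
Qed.

Definition ell (R : realType) (n : nat) (mu : 'I_n -> R) (j : 'I_n) : R :=
  \prod_(i < n | i != j) (mu j / (mu j - mu i)).

Definition lin_comb_density (R : realType) (n : nat) (mu : 'I_n -> R)
    (f : R -> R) (x : R) : R :=
  if 0 <= x then \sum_(j < n) ell mu j / mu j * f (x / mu j) else 0.

(* Main.v *)
Require Import Defs.
From HB Require Import structures.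
From mathcomp Require Import all_boot all_order all_algebra.
From mathcomp Require Import all_classical all_reals all_analysis.
From mathcomp Require Import measurable_realfun ring lra.

(* Writing phi for the Laplace transform of X, independence turns the density
   of S_n into prod_j phi(mu_j t) = sum_j l_j phi(mu_j t) for t >= 0, an
   equation which 1/(1 + m t) also solves, by partial fractions.  If phi agrees
   with 1/(1 + m t), m = E X, up to an error delta t^k + O(t^(k+1)), k >= 2,
   comparing the coefficients of t^k gives delta (p_k - h_k) = 0, where p_k is
   the power sum of the mu_j and h_k = sum_j l_j mu_j^k their complete
   homogeneous symmetric polynomial; as h_k > p_k, delta = 0.  Hence
   E X^k = k! m^k for all k and phi(t) = 1/(1 + m t) for small t.  The equation
   determines phi at the largest mu_j t from the other ones, because the
   corresponding l_j exceeds 1 >= phi, so the identity propagates to all t >= 0.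
   The law is recovered from phi through P(X > a) =
   lim_N E (1 - e^(-N s X))^(2^N) with s = ln 2 / a. *)

Set Implicit Arguments.
Unset Strict Implicit.
Unset Printing Implicit Defensive.

Import Order.TTheory GRing.Theory Num.Theory.
Import numFieldNormedType.Exports.

Local Open Scope classical_set_scope.
Local Open Scope ring_scope.

(** * Lagrange weights *)

(** Indexing by a list instead of a finite type allows induction on the nodes; over
    [index_enum 'I_n] these are the weights [ell]. *)
Definition lagrange_weight (F : fieldType) (I : eqType) (mu : I -> F)
    (s : seq I) (j : I) : F :=
  \prod_(i <- s | i != j) (mu j / (mu j - mu i)).

(** Clearing denominators turns the identity into [p = 0], for a polynomial of degree below [size s]
    that vanishes at the [size s] distinct points [- (mu j)^-1]. *)
Lemma partial_fractions (F : fieldType) (I : eqType) (mu : I -> F) (s : seq I)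
    (z : F) :
    injective mu -> (forall i, mu i != 0) -> uniq s -> s != [::] ->
    (forall i, 1 + z * mu i != 0) ->
  \prod_(i <- s) (1 + z * mu i)^-1 =
  \sum_(j <- s) lagrange_weight mu s j * (1 + z * mu j)^-1.
Proof.
move=> mu_inj mu0 us s0 z0.
pose q (j : I) : {poly F} := \prod_(i <- s | i != j) (1 + mu i *: 'X).
have qE j x : (q j).[x] = \prod_(i <- s | i != j) (1 + x * mu i).
  rewrite /q horner_prod; apply: eq_bigr => i _.
  by rewrite !hornerE mulrC.
pose p : {poly F} := \sum_(j <- s) lagrange_weight mu s j *: q j - 1%:P.
have szl i : (size (1 + mu i *: 'X : {poly F})%R <= 2)%N.
  rewrite (leq_trans (size_polyD _ _))// geq_max size_poly1/=.
  by rewrite (leq_trans (size_scale_leq _ _))// size_polyX.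
have szq j : j \in s -> (size (q j) <= size s)%N.
  move=> js; rewrite /q -big_filter.
  have -> : [seq i <- s | i != j] = rem j s by rewrite rem_filter.
  have : (size (rem j s)).+1 = size s.
    by rewrite size_rem// prednK//; case: (s) js.
  move=> <-; elim: (rem j s) => [|i r ih]; first by rewrite big_nil size_poly1.
  rewrite big_cons (leq_trans (size_polyMleq _ _))//=.
  by have := leq_add (szl i) ih; case: (_ + _)%N.
have szp : (size p <= size s)%N.
  rewrite (leq_trans (size_polyD _ _))// geq_max size_polyN polyC1 size_poly1.
  rewrite andbC; apply/andP; split; first by case: (s) s0.
  rewrite big_seq; elim/big_ind : _ => [|a b ha hb|j js].
  - by rewrite size_poly0.
  - by rewrite (leq_trans (size_polyD _ _))// geq_max ha.
  - by rewrite (leq_trans (size_scale_leq _ _))// szq.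
have rootp : all (root p) [seq - (mu j)^-1 | j <- s].
  apply/allP => _ /mapP[j js ->]; rewrite /root /p hornerD horner_sum hornerN.
  rewrite hornerC subr_eq0; apply/eqP.
  (* At [- (mu j)^-1] each [q i] with [i != j] has a zero factor, the one of index [j], and the
     weight of [j] is the inverse of the value of [q j]. *)
  rewrite (bigD1_seq j)//= big1_seq ?addr0; last first.
    move=> i /andP[ij _]; rewrite hornerZ qE.
    apply/eqP; rewrite mulf_eq0; apply/orP; right; rewrite prodf_seq_eq0.
    by apply/hasP; exists j => //=; rewrite eq_sym ij /= mulNr mulVf ?subrr.
  rewrite hornerZ qE -big_split/= big1// => i ij.
  have ji : mu j - mu i != 0 by rewrite subr_eq0 (inj_eq mu_inj) eq_sym.
  have mj := mu0 j.
  by field; rewrite mj ji.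
have p0 : p = 0.
  apply: (roots_geq_poly_eq0 rootp); last by rewrite size_map.
  by rewrite map_inj_uniq// => x y /oppr_inj/invr_inj/mu_inj.
have : p.[z] = 0 by rewrite p0 horner0.
rewrite /p hornerD horner_sum hornerN hornerC => /eqP.
rewrite subr_eq0 => /eqP; under [in X in X -> _]eq_bigr do rewrite hornerZ qE.
move=> /(congr1 (fun x => x * \prod_(i <- s) (1 + z * mu i)^-1)).
rewrite mul1r mulr_suml => <-; apply: eq_big_seq => j js.
rewrite -mulrA; congr (_ * _).
rewrite [X in _ * X](bigD1_seq j)//= mulrCA -big_split/= big1 ?mulr1// => i _.
by rewrite mulfV.
Qed.

(** The partial fractions at [z = 0]. *)
Lemma sum_lagrange_weight (F : fieldType) (I : eqType) (mu : I -> F)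
    (s : seq I) :
    injective mu -> (forall i, mu i != 0) -> uniq s -> s != [::] ->
  \sum_(j <- s) lagrange_weight mu s j = 1.
Proof.
move=> mu_inj mu0 us s0.
have e i : 1 + 0 * mu i = 1 by rewrite mul0r addr0.
have := @partial_fractions F I mu s 0 mu_inj mu0 us s0.
rewrite big1 => [->|i _]; last by rewrite e invr1.
  by apply: eq_bigr => i _; rewrite e invr1 mulr1.
by move=> i; rewrite e oner_neq0.
Qed.

(* The [k]-th weighted power sum is the complete homogeneous symmetric
   polynomial of degree [k]; this is its usual recurrence. *)
Lemma lagrange_weight_cons (F : fieldType) (I : eqType) (mu : I -> F)
    (a : I) (s : seq I) (k : nat) :
    injective mu -> (forall i, mu i != 0) -> uniq (a :: s) ->
  \sum_(j <- a :: s) lagrange_weight mu (a :: s) j * mu j ^+ k.+1 =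
  \sum_(j <- s) lagrange_weight mu s j * mu j ^+ k.+1 +
  mu a * \sum_(j <- a :: s) lagrange_weight mu (a :: s) j * mu j ^+ k.
Proof.
move=> mu_inj mu0 /= /andP[as_ us].
apply/eqP; rewrite -subr_eq; apply/eqP.
(* The term of [a] cancels; in the others [mu j - mu a] cancels the denominator of the factor that
   [a] adds to the weight. *)
rewrite mulr_sumr -sumrB big_cons exprS mulrCA subrr add0r.
apply: eq_big_seq => j js.
have aj : a != j by apply: contraNneq as_ => ->.
have ja : mu j - mu a != 0 by rewrite subr_eq0 (inj_eq mu_inj) eq_sym.
by rewrite /lagrange_weight big_cons aj exprS; field.
Qed.

(** The recurrence bounds the right side from below, node by node, by [mu a] times the sum of the
    previous degree, which is at least [mu a ^+ k]. Degree [0] is excluded: there the weighted sum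
    is only [1]. *)
Lemma power_sum_le (F : realFieldType) (I : eqType) (mu : I -> F)
    (s : seq I) (k : nat) :
    injective mu -> (forall i, 0 < mu i) -> uniq s ->
  \sum_(j <- s) mu j ^+ k.+1 <=
  \sum_(j <- s) lagrange_weight mu s j * mu j ^+ k.+1.
Proof.
move=> mu_inj mu_gt0; have mu0 i : mu i != 0 by rewrite gt_eqF.
elim: s k => [|a s ih] k us; first by rewrite !big_nil.
have /andP[_ us'] := us.
elim: k => [|k ihk].
  rewrite lagrange_weight_cons// big_cons addrC lerD ?ih//.
  under eq_bigr do rewrite expr0 mulr1.
  by rewrite sum_lagrange_weight// mulr1 expr1.
rewrite lagrange_weight_cons// big_cons addrC lerD ?ih//.
rewrite exprS ler_wpM2l ?(ltW (mu_gt0 _))// (le_trans _ ihk)//.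
by rewrite big_cons lerDl sumr_ge0// => i _; rewrite exprn_ge0// ltW.
Qed.

(** In degree [1] both sides equal the sum of the [mu j]; strictness starts in degree [2], where the
    mixed product of two nodes occurs on the right only. *)
Lemma power_sum_lt (F : realFieldType) (I : eqType) (mu : I -> F)
    (s : seq I) (k : nat) :
    injective mu -> (forall i, 0 < mu i) -> uniq s -> (1 < size s)%N ->
  \sum_(j <- s) mu j ^+ k.+2 <
  \sum_(j <- s) lagrange_weight mu s j * mu j ^+ k.+2.
Proof.
move=> mu_inj mu_gt0; have mu0 i : mu i != 0 by rewrite gt_eqF.
case: s => // a [//|b s] us _; have /andP[_ us'] := us.
rewrite lagrange_weight_cons// big_cons addrC.
apply: ler_ltD; first exact: power_sum_le.
apply: lt_le_trans (_ : mu a * \sum_(j <- [:: a, b & s]) mu j ^+ k.+1 <= _).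
  rewrite exprS ltr_pM2l// 2!big_cons ltrDl ltr_pwDl ?exprn_gt0//.
  by rewrite sumr_ge0// => i _; rewrite exprn_ge0// ltW.
by rewrite ler_wpM2l ?(ltW (mu_gt0 _))// power_sum_le.
Qed.

(** * Rigidity of the functional equation *)

(** Fixing the interval [[0, 1]] lets the constants add and multiply without shrinking a
    neighbourhood of [0]. *)
Definition bigO01 (R : realType) (k : nat) (f : R -> R) :=
  exists C, forall t, 0 <= t <= 1 -> `|f t| <= C * t ^+ k.

Section bigO01_theory.
Variable R : realType.
Implicit Types (f g : R -> R) (k : nat).

Lemma bigO01_eq k f g : (forall t, f t = g t) -> bigO01 k f -> bigO01 k g.
Proof. by move=> fg [C fC]; exists C => t /fC; rewrite fg. Qed.

Lemma bigO01W k l f : (k <= l)%N -> bigO01 l f -> bigO01 k f.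
Proof.
move=> kl [C fC]; exists `|C| => t t01; have /andP[t0 t1] := t01.
rewrite (le_trans (fC _ t01))// (le_trans (ler_norm _))// normrM ler_wpM2l//.
by rewrite ger0_norm ?exprn_ge0// ler_wiXn2l.
Qed.

Lemma bigO01D k f g : bigO01 k f -> bigO01 k g ->
  bigO01 k (fun t => f t + g t).
Proof.
move=> [C fC] [D gD]; exists (C + D) => t t01.
by rewrite (le_trans (ler_normD _ _))// mulrDl lerD ?fC ?gD.
Qed.

Lemma bigO01M k l f g : bigO01 k f -> bigO01 l g ->
  bigO01 (k + l) (fun t => f t * g t).
Proof.
move=> [C fC] [D gD]; exists (C * D) => t t01.
by rewrite normrM exprD mulrACA ler_pM ?fC ?gD.
Qed.

Lemma bigO01_cst k (a : R) : bigO01 k (fun t => a * t ^+ k).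
Proof.
exists `|a| => t /andP[t0 _].
by rewrite normrM (ger0_norm (exprn_ge0 _ _)).
Qed.

Lemma bigO01Z k (a : R) f : bigO01 k f -> bigO01 k (fun t => a * f t).
Proof.
move=> fk; have := bigO01M (bigO01_cst 0 a) fk.
by apply: bigO01_eq => t; rewrite expr0 mulr1.
Qed.

Lemma bigO01_sum k (I : Type) (s : seq I) (f : I -> R -> R) :
  (forall i, bigO01 k (f i)) -> bigO01 k (fun t => \sum_(i <- s) f i t).
Proof.
move=> fk; elim: s => [|i s ih].
  by exists 0 => t _; rewrite big_nil normr0 mul0r.
by apply: bigO01_eq (bigO01D (fk i) ih) => t; rewrite big_cons.
Qed.

Lemma bigO01_bounded f : bigO01 1 (fun t => f t - 1) -> bigO01 0 f.
Proof.
move=> f1; have := bigO01D (bigO01W (leq0n 1) f1) (bigO01_cst 0 1).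
by apply: bigO01_eq => t; rewrite expr0 mulr1 subrK.
Qed.

(** Dividing by [t ^+ k] leaves a bound on [|a|] that is linear in [t], to be used at small [t]. *)
Lemma bigO01_cst_eq0 k (a : R) : bigO01 k.+1 (fun t => a * t ^+ k) -> a = 0.
Proof.
move=> [C aC]; apply/eqP; rewrite -normr_eq0; apply/negPn/negP => a0.
have a_gt0 : 0 < `|a| by rewrite lt_def a0/=.
have C1 : 0 < `|C| + 1 by rewrite ltr_wpDl.
have {}aC t : 0 < t <= 1 -> `|a| <= (`|C| + 1) * t.
  move=> /andP[t0 t1]; have := aC t; rewrite (ltW t0) t1 => /(_ isT).
  rewrite normrM (ger0_norm (exprn_ge0 _ (ltW t0))) exprS mulrA.
  rewrite ler_pM2r ?exprn_gt0// => /le_trans; apply.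
  by rewrite ler_wpM2r ?(ltW t0)// (le_trans (ler_norm _))// lerDl.
(* At this point the bound is at most half of [|a|]; the minimum with [1] keeps it in the unit
   interval. *)
have := aC (Num.min 1 (`|a| / (`|C| + 1) / 2)).
rewrite lt_min ltr01 !divr_gt0//= ge_min lexx/= => /(_ isT).
apply/negP; rewrite -ltNge.
have : (`|C| + 1) * Num.min 1 (`|a| / (`|C| + 1) / 2) <= `|a| / 2.
  rewrite (_ : `|a| / 2 = (`|C| + 1) * (`|a| / (`|C| + 1) / 2)); last first.
    by field; rewrite gt_eqF.
  by rewrite ler_wpM2l ?ge_min ?lexx ?orbT// ltW.
by move=> /le_lt_trans; apply; lra.
Qed.

(** A product of factors [1 + O(t)] is linearised: perturbing each by [d i * t ^+ k] perturbs the
    product by the sum, all cross terms having order [k.+1]. *)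
Lemma bigO01_prod (I : Type) (s : seq I) k (a e : I -> R -> R) (d : I -> R) :
    (0 < k)%N ->
    (forall i, bigO01 1 (fun t => e i t - 1)) ->
    (forall i, bigO01 k.+1 (fun t => a i t - e i t - d i * t ^+ k)) ->
  bigO01 k.+1 (fun t => \prod_(i <- s) a i t - \prod_(i <- s) e i t -
                        (\sum_(i <- s) d i) * t ^+ k).
Proof.
move=> k0 e1 ae.
have a1 i : bigO01 1 (fun t => a i t - 1).
  have := bigO01D (bigO01D (bigO01W (isT : 1 <= k.+1)%N (ae i)) (e1 i))
    (bigO01W k0 (bigO01_cst k (d i))).
  by apply: bigO01_eq => t; ring.
have pe1 r : bigO01 1 (fun t => \prod_(i <- r) e i t - 1).
  elim: r => [|i r ih].
    by exists 0 => t _; rewrite big_nil subrr normr0 mul0r.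
  have := bigO01D (bigO01M (bigO01_bounded (e1 i)) ih) (e1 i).
  by apply: bigO01_eq => t; rewrite big_cons; ring.
elim: s => [|i s ih].
  by exists 0 => t _; rewrite !big_nil subrr sub0r mul0r oppr0 normr0 mul0r.
(* The new error is the sum of four products: [A] carries the error of the tail, [B] that of the
   head, [C] and [D] the replacement of a bounded factor by [1]. *)
have A := bigO01M (bigO01_bounded (a1 i)) ih.
have B := bigO01M (ae i) (bigO01_bounded (pe1 s)).
have C := bigO01M (a1 i) (bigO01_cst k (\sum_(i <- s) d i)).
have D := bigO01M (pe1 s) (bigO01_cst k (d i)).
rewrite addn0 in B.
have := bigO01D (bigO01D A B) (bigO01D C D).
by apply: bigO01_eq => t; rewrite !big_cons; ring.
Qed.

End bigO01_theory.

(** * Solutions of the functional equation with a Taylor expansion *)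

Section laplace_rigidity.
Variables (R : realType) (I : eqType) (mu : I -> R) (s : seq I).
Hypotheses (mu_inj : injective mu) (mu_gt0 : forall i, 0 < mu i).
Hypotheses (us : uniq s) (s2 : (1 < size s)%N).
(** [phi] stands for the Laplace transform of [X] and [c k] for its [k]-th moment divided by
    [k!]. *)
Variables (phi : R -> R) (c : nat -> R).
Hypotheses (c0 : c 0%N = 1) (c1 : 0 < c 1%N).
Hypothesis phi_taylor : forall K t, 0 <= t ->
  `|phi t - \sum_(i < K) c i * (- t) ^+ i| <= c K * t ^+ K.
Hypothesis phi_eq : forall t, 0 <= t ->
  \prod_(i <- s) phi (mu i * t) =
  \sum_(j <- s) lagrange_weight mu s j * phi (mu j * t).

Let m := c 1%N.
Let e (t : R) := (1 + m * t)^-1.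

Let mu0 i : mu i != 0. Proof. by rewrite gt_eqF. Qed.

Let e_gt0 t : 0 <= t -> 0 < 1 + m * t.
Proof. by move=> t0; rewrite ltr_wpDr// mulr_ge0// ltW. Qed.

(** The geometric sum leaves the remainder [(- (m * t)) ^+ K / (1 + m * t)], whose denominator is at
    least [1]. *)
Let e_taylor K t : 0 <= t ->
  `|e t - \sum_(i < K) m ^+ i * (- t) ^+ i| <= m ^+ K * t ^+ K.
Proof.
move=> t0; have et := e_gt0 t0.
have et0 : 1 + m * t != 0 by rewrite gt_eqF.
have -> : e t - \sum_(i < K) m ^+ i * (- t) ^+ i =
    (- (m * t)) ^+ K / (1 + m * t).
  apply: (mulIf et0); rewrite divfK//.
  rewrite mulrBl /e mulVf//; under eq_bigr do rewrite -exprMn mulrN.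
  have -> : (\sum_(i < K) (- (m * t)) ^+ i) * (1 + m * t) =
    - ((- (m * t) - 1) * (\sum_(i < K) (- (m * t)) ^+ i)) by ring.
  by rewrite -subrX1; ring.
rewrite normrM normfV (gtr0_norm et) normrX normrN ger0_norm ?mulr_ge0 ?(ltW c1)//.
rewrite -exprMn ler_pdivrMr// ler_peMr ?exprn_ge0 ?mulr_ge0 ?(ltW c1)//.
by rewrite lerDl mulr_ge0// ltW.
Qed.

Let e_eq t : 0 <= t ->
  \prod_(i <- s) e (mu i * t) =
  \sum_(j <- s) lagrange_weight mu s j * e (mu j * t).
Proof.
move=> t0; have s0 : s != [::] by case: (s) s2.
have z0 i : 1 + (m * t) * mu i != 0.
  by rewrite gt_eqF// ltr_wpDr// !mulr_ge0// ltW.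
have := partial_fractions mu_inj mu0 us s0 z0.
have E i : (1 + (m * t) * mu i)^-1 = e (mu i * t).
  by rewrite /e -mulrA [t * _]mulrC.
under eq_bigr do rewrite E.
by under [in X in _ = X -> _]eq_bigr do rewrite E.
Qed.

Let phi_coef k : c k = m ^+ k.
Proof.
elim/ltn_ind: k => -[_|[_|k ih]]; [by rewrite c0|by rewrite expr1|].
(* Hiding the form [k.+2] of [K] makes [big_ord_recr] split off the last term only. *)
have [K EK] : exists K, K = k.+2 by exists k.+2.
have K0 : (0 < K)%N by rewrite EK.
rewrite -EK in ih *; pose d := (-1) ^+ K * (c K - m ^+ K).
(* By induction the two expansions agree below degree [K], so [phi - e] starts with [d * t ^+ K]. *)
have bd t : 0 <= t -> `|phi t - e t - d * t ^+ K| <=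
    (c K.+1 + m ^+ K.+1) * t ^+ K.+1.
  move=> t0; rewrite mulrDl.
  apply: le_trans (lerD (phi_taylor K.+1 t0) (e_taylor K.+1 t0)).
  rewrite -[X in _ <= _ + X]normrN; apply: le_trans (ler_normD _ _).
  rewrite le_eqVlt; apply/orP; left; apply/eqP; congr `|_|.
  rewrite !big_ord_recr/=.
  rewrite (eq_bigr (fun i : 'I_K => m ^+ i * (- t) ^+ i)); last first.
    by move=> i _; rewrite ih.
  by rewrite /d -[- t]mulN1r exprMn; ring.
have cK : 0 <= c K.+1 + m ^+ K.+1.
  by have := bd 1 ler01; rewrite !expr1n !mulr1 => /(le_trans (normr_ge0 _)).
have O1 i : bigO01 1 (fun t => e (mu i * t) - 1).
  exists (m * mu i) => t /andP[t0 _]; rewrite expr1.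
  have := e_taylor 1 (mulr_ge0 (ltW (mu_gt0 i)) t0).
  by rewrite big_ord_recr big_ord0/= add0r !expr0 mulr1 !expr1 mulrA.
have O2 i : bigO01 K.+1
    (fun t => phi (mu i * t) - e (mu i * t) - (d * mu i ^+ K) * t ^+ K).
  exists ((c K.+1 + m ^+ K.+1) * mu i ^+ K.+1) => t /andP[t0 _].
  have := bd _ (mulr_ge0 (ltW (mu_gt0 i)) t0).
  by rewrite !exprMn !mulrA.
(* [A] expands the difference of the two products and [B] that of the two weighted sums. The
   functional equations make these differences equal, so their leading coefficients [d * p] and
   [d * h] must agree. *)
have A := bigO01_prod s K0 O1 O2.
have B := bigO01_sum s (fun i => bigO01Z (lagrange_weight mu s i) (O2 i)).
have := bigO01D A (bigO01Z (-1) B).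
set h := \sum_(j <- s) lagrange_weight mu s j * mu j ^+ K.
set p := \sum_(j <- s) mu j ^+ K.
move=> AB; have : bigO01 K.+1 (fun t => (d * (h - p)) * t ^+ K).
  move: AB => [C AB]; exists C => t t01; have /andP[t0 _] := t01.
  have := AB _ t01; congr (_ <= _); congr `|_|.
  rewrite phi_eq// e_eq//.
  under [X in -1 * X]eq_bigr do rewrite mulrBr mulrBr.
  rewrite !sumrB -mulr_sumr -/p.
  rewrite [X in -1 * (_ - X)](_ : _ = d * h * t ^+ K); first by ring.
  by rewrite /h mulr_sumr mulr_suml; apply: eq_bigr => i _; ring.
move=> /bigO01_cst_eq0/eqP; rewrite mulf_eq0 subr_eq0 => /orP[|/eqP hp].
  by rewrite mulf_eq0 signr_eq0/= subr_eq0 => /eqP.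
by have := power_sum_lt k mu_inj mu_gt0 us s2; rewrite -EK -/h -/p hp ltxx.
Qed.

Let exp_small (q : R) (a b : R) : 0 < q < 1 -> 0 < b -> exists N, a * q ^+ N <= b.
Proof.
move=> /andP[q0 q1] b0.
have : a * q ^+ n @[n --> \oo] --> a * 0.
  by apply: cvgMr; apply: cvg_expr; rewrite gtr0_norm.
rewrite mulr0 => /cvgr_le/(_ _ b0)[N _ h]; by exists N; apply: h => /=.
Qed.

(** All Taylor polynomials of [phi] and [e] coincide, and both errors of order [N] are at most
    [2^-N] in this range. *)
Let phi_near0 t : 0 <= t -> m * t <= 2^-1 -> phi t = e t.
Proof.
move=> t0 mt; apply/eqP; rewrite -subr_eq0 -normr_le0; apply/ler_addgt0Pr => b b0.
rewrite add0r.
have half : 0 < (2^-1 : R) < 1 by apply/andP; split; lra.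
have [N hN] := exp_small 2 half b0.
apply: le_trans hN.
have := lerD (phi_taylor N t0) (e_taylor N t0).
rewrite -[X in _ + X <= _]normrN => /(le_trans (ler_normD _ _)).
rewrite phi_coef.
under [in X in `|X| <= _]eq_bigr do rewrite phi_coef.
rewrite (_ : _ - _ + _ = phi t - e t); last by ring.
move=> /le_trans; apply.
rewrite -exprMn -mulr2n -[leLHS]mulr_natl ler_wpM2l//.
by rewrite lerXn2r// nnegrE ?mulr_ge0 ?(ltW c1).
Qed.

(** Among finitely many distinct nodes a single ratio [q] separates the largest from the rest; this
    is the contraction factor of the propagation. *)
Let dominant : exists2 j0, j0 \in s &
  exists2 q, 0 < q < 1 & forall i, i \in s -> i != j0 -> mu i <= q * mu j0.
Proof.
have [j0 j0s maxj0] : exists2 j0, j0 \in s & forall i, i \in s -> mu i <= mu j0.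
  have : s != [::] by case: (s) s2.
  elim: (s) => // a [|b r] ih _.
    by exists a; rewrite ?mem_head// => i; rewrite inE => /eqP ->.
  have [j jr hj] := ih isT.
  have [aj|ja] := leP (mu a) (mu j).
    exists j; first by rewrite inE jr orbT.
    by move=> i; rewrite inE => /predU1P[->//|/hj].
  exists a; first exact: mem_head.
  by move=> i; rewrite inE => /predU1P[->//|/hj/le_trans]; apply; exact: ltW.
exists j0 => //; move: maxj0; elim: (s) => [|a r ih] maxj0.
  (* Any ratio in the open unit interval serves for the empty list. *)
  by exists 2^-1 => //; apply/andP; split; lra.
have [i ir|q /andP[q0 q1] hq] := ih.
  by apply: maxj0; rewrite inE ir orbT.
have [->|aj0] := eqVneq a j0.
  exists q; rewrite ?q0//.
  by move=> i; rewrite inE => /predU1P[->|ir ij]; [rewrite eqxx|exact: hq].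
have amu : mu a < mu j0.
  by rewrite lt_neqAle (inj_eq mu_inj) aj0/= maxj0 ?mem_head.
have r1 : mu a / mu j0 < 1 by rewrite ltr_pdivrMr// mul1r.
exists (Num.max q (mu a / mu j0)); first by rewrite lt_max q0 gt_max q1.
move=> i; rewrite inE => /predU1P[->|ir] ij.
  by rewrite -ler_pdivrMr// le_max lexx orbT.
by rewrite (le_trans (hq _ ir ij))// ler_wpM2r ?(ltW (mu_gt0 _))// le_max lexx.
Qed.

Lemma laplace_rigidity t : 0 <= t -> phi t = (1 + c 1%N * t)^-1.
Proof.
have [j0 j0s [q /andP[q0 q1] hq]] := dominant.
have s0 : s != [::] by case: (s) s2.
(* The ranges [m * u * q ^+ N <= 2^-1] exhaust the half-line as [N] grows; the induction passes from
   each to the next. *)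
suff H N u : 0 <= u -> m * u * q ^+ N <= 2^-1 -> phi u = e u.
  move=> t0; have [N hN] : exists N, m * t * q ^+ N <= 2^-1.
    by apply: exp_small; rewrite ?q0// invr_gt0.
  exact: H hN.
elim: N u => [|N ih] u u0 hu.
  by apply: phi_near0 => //; rewrite -[leLHS]mulr1.
(* With [u] as the argument at the largest node, the arguments at the other nodes are at most
   [q * u], in the range already covered. *)
pose v := u / mu j0.
have v0 : 0 <= v by rewrite divr_ge0// ltW.
have uE : u = mu j0 * v by rewrite mulrC divfK.
have phie i : i \in s -> i != j0 -> phi (mu i * v) = e (mu i * v).
  move=> is_ ij; apply: ih; first by rewrite mulr_ge0// ltW.
  apply: le_trans hu.
  rewrite [leRHS](_ : _ = m * (q * mu j0 * v) * q ^+ N); last first.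
    by rewrite exprS -[q * mu j0 * v]mulrA -uE; ring.
  rewrite ler_wpM2r ?exprn_ge0 ?(ltW q0)// ler_wpM2l ?(ltW c1)//.
  by rewrite ler_wpM2r ?hq.
(* Each factor of the weight at the largest node exceeds [1], and there is at least one factor. *)
have l1 : 1 < lagrange_weight mu s j0.
  have gt1 i : i \in s -> i != j0 -> 1 < mu j0 / (mu j0 - mu i).
    move=> is_ ij.
    have ltj : mu i < mu j0.
      by rewrite (le_lt_trans (hq _ is_ ij))// gtr_pMl.
    by rewrite ltr_pdivlMr ?subr_gt0// mul1r ltrBlDr ltrDl.
  rewrite /lagrange_weight -big_filter.
  have : [seq i <- s | i != j0] != [::].
    by rewrite -size_eq0 -(rem_filter _ us) size_rem// -lt0n; case: (size s) s2.
  have : forall i, i \in [seq i <- s | i != j0] -> 1 < mu j0 / (mu j0 - mu i).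
    by move=> i; rewrite mem_filter => /andP[ij is_]; exact: gt1.
  elim: [seq i <- s | i != j0] => // a r ihr hr _; rewrite big_cons.
  have a1 := hr a (mem_head _ _).
  case: r ihr hr => [_ _|b r ihr hr]; first by rewrite big_nil mulr1.
  rewrite mulr_egt1// ihr// => i ir; apply: hr.
  by rewrite inE ir orbT.
have := congr2 (fun x y => x - y) (phi_eq v0) (e_eq v0).
rewrite !(bigD1_seq j0)//= -!uE.
have -> : \prod_(i <- s | i != j0) phi (mu i * v) =
    \prod_(i <- s | i != j0) e (mu i * v).
  rewrite big_seq_cond [RHS]big_seq_cond.
  by apply: eq_bigr => i /andP[]; exact: phie.
have -> : \sum_(i <- s | i != j0) lagrange_weight mu s i * phi (mu i * v) =
    \sum_(i <- s | i != j0) lagrange_weight mu s i * e (mu i * v).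
  rewrite big_seq_cond [RHS]big_seq_cond.
  by apply: eq_bigr => i /andP[is_ ij]; rewrite phie.
set Q := \prod_(i <- s | _) _; set S := \sum_(i <- s | _) _.
have Q1 : Q <= 1.
  apply: prodr_ile1 => i _.
  have iv0 : 0 <= mu i * v by rewrite mulr_ge0// ltW.
  rewrite /e invr_ge0 (ltW (e_gt0 iv0))/= invf_le1 ?e_gt0// lerDl mulr_ge0//.
  exact: ltW.
(* With all other values known, the equation is affine in the value at [u], with slope [Q] minus the
   weight of [j0], which is negative. *)
move=> h; have : (phi u - e u) * (Q - lagrange_weight mu s j0) = 0.
  rewrite mulrBl !mulrBr; move: h.
  by set L := lagrange_weight _ _ _ => h; lra.
move=> /eqP; rewrite mulf_eq0 !subr_eq0 => /orP[/eqP//|/eqP QL].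
by move: l1; rewrite -QL ltNge Q1.
Qed.

End laplace_rigidity.

(** * Integration against densities and products of independent variables *)

Section integral_weight.
Import HBNNSimple.
Local Open Scope ereal_scope.
Context d d' (T : measurableType d) (T' : measurableType d') (R : realType).
Variables (m : {measure set T -> \bar R}) (nu : {measure set T' -> \bar R}).
Variables (Y : T -> T') (w : T -> R).
Hypotheses (mY : measurable_fun setT Y) (mw : measurable_fun setT w).
Hypothesis w0 : forall x, (0 <= w x)%R.
Hypothesis nuE : forall A, measurable A ->
  nu A = \int[m]_(x in Y @^-1` A) (w x)%:E.

Let integral_weight_indic A : measurable A ->
  \int[nu]_y (\1_A y)%:E = \int[m]_x ((\1_A (Y x))%:E * (w x)%:E).
Proof.
move=> mA; rewrite integral_indic// setIT nuE// integral_mkcond.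
apply: eq_integral => x _; rewrite patchE indicE.
have -> : (x \in Y @^-1` A) = (Y x \in A) by apply/idP/idP; rewrite !inE.
by case: ifPn => _; rewrite ?mul1e ?mul0e.
Qed.

Let integral_weight_nnsfun (h : {nnsfun T' >-> R}) :
  \int[nu]_y (h y)%:E = \int[m]_x ((h (Y x))%:E * (w x)%:E).
Proof.
have mh r : measurable (h @^-1` [set r]) by [].
under eq_integral do rewrite fimfunE -fsumEFin//.
rewrite ge0_integral_fsum//; last 2 first.
- by move=> r; exact/measurable_EFinP/measurable_funM.
- by move=> r x _; rewrite nnfun_muleindic_ge0.
have mi r : measurable_fun setT (fun x => (\1_(h @^-1` [set r]) (Y x))%:E : \bar R).
  apply/measurable_EFinP/measurableT_comp => //.
have h0 r x : 0 <= (\1_(h @^-1` [set r]) (Y x))%:E * (w x)%:E.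
  by rewrite mule_ge0 ?lee_fin.
transitivity (\sum_(r \in range h)
    \int[m]_x (r%:E * ((\1_(h @^-1` [set r]) (Y x))%:E * (w x)%:E))).
  apply: eq_fsbigr => r rh.
  rewrite integralZl_indic_nnsfun// integral_weight_indic//.
  have [y _ yr] : range h r by rewrite -in_setE.
  rewrite ge0_integralZl_EFin//.
  - by apply: emeasurable_funM => //; exact/measurable_EFinP.
  - by rewrite -yr.
rewrite -ge0_integral_fsum//; last 2 first.
- move=> r; apply: emeasurable_funM => //; apply: emeasurable_funM => //.
  exact/measurable_EFinP.
- move=> r x _; rewrite muleA mule_ge0 ?lee_fin//.
  exact: nnfun_muleindic_ge0.
apply: eq_integral => x _; rewrite [in RHS]fimfunE -fsumEFin//.
rewrite ge0_mule_fsuml; last by move=> r; exact: nnfun_muleindic_ge0.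
by apply: eq_fsbigr => r _; rewrite muleA.
Qed.

(** Simple functions and monotone convergence extend [nuE] from indicators. The general form serves
    for independence ([w] the other factors), for densities ([Y] the identity) and for scaling ([w]
    constant). *)
Lemma ge0_integral_weight (h : T' -> \bar R) :
    measurable_fun setT h -> (forall y, 0 <= h y) ->
  \int[nu]_y h y = \int[m]_x (h (Y x) * (w x)%:E).
Proof.
move=> mh h0; pose f_ := nnsfun_approx measurableT mh.
have f_cvg y : (f_ n y)%:E @[n --> \oo] --> h y by exact: cvg_nnsfun_approx.
transitivity (limn (fun n => \int[nu]_y (f_ n y)%:E)).
  rewrite -monotone_convergence//=.
  - by apply: eq_integral => y _; apply/esym/cvg_lim.
  - by move=> n; exact/measurable_EFinP.
  - by move=> n x _; rewrite lee_fin.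
  - by move=> x _ a b ab; rewrite lee_fin//; exact/lefP/nd_nnsfun_approx.
under eq_fun do rewrite integral_weight_nnsfun.
rewrite -monotone_convergence//=.
- apply: eq_integral => x _; apply/cvg_lim => //.
  by apply: cvgeZr => //; exact: f_cvg.
- move=> n; apply: emeasurable_funM; apply/measurable_EFinP => //.
  exact: measurableT_comp.
- by move=> n x _; rewrite mule_ge0 ?lee_fin.
- move=> x _ a b ab; rewrite lee_wpmul2r ?lee_fin//.
  exact/lefP/nd_nnsfun_approx.
Qed.

End integral_weight.

Section expectation_prod.
Local Open Scope ereal_scope.
Context d (T : measurableType d) (R : realType) (P : probability T R).
Context (I : finType) (Y : I -> {RV P >-> R}).
Hypothesis indepY : mutually_independent Y.

Lemma expectation_prod_independent (g : I -> R -> R) :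
    (forall i, measurable_fun setT (g i)) -> (forall i x, (0 <= g i x <= 1)%R) ->
  \int[P]_w (\prod_(i : I) g i (Y i w))%:E =
  \prod_(i : I) \int[P]_w (g i (Y i w))%:E.
Proof.
move=> mg g01.
(* Indicators are replaced by the given functions one index at a time: outside [s] the factors are
   indicators, so the empty list is the definition of independence and [enum I] is the claim. *)
suff H (s : seq I) : uniq s -> forall h : I -> R -> R,
   (forall i, i \in s -> h i = g i) ->
   (forall i, i \notin s -> exists2 A, measurable A & h i = \1_A) ->
  \int[P]_w (\prod_(i : I) h i (Y i w))%:E =
  \prod_(i : I) \int[P]_w (h i (Y i w))%:E.
  apply: (H (enum I) (enum_uniq _)) => // i; by rewrite mem_enum.
elim: s => [_ h _ hA|j s ih /= /andP[js us] h hg hA].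
  have {}hA i : {A | measurable A & h i = \1_A} by apply: cid2; exact: hA.
  pose A i := s2val (hA i).
  have mA i : measurable (A i) by rewrite /A; case: (hA i).
  have hE i x : h i x = \1_(A i) x by rewrite /A; case: (hA i) => /= B _ ->.
  have mYA i : measurable (Y i @^-1` A i) by apply: measurable_funPTI.
  have -> : \int[P]_w (\prod_(i : I) h i (Y i w))%:E =
      P (\bigcap_(i in [set` [set: I]%SET]) Y i @^-1` A i).
    have mB : measurable (\bigcap_(i in [set` [set: I]%SET]) Y i @^-1` A i).
      exact: fin_bigcap_measurable.
    rewrite -[in RHS](setIT (\bigcap_(i in _) _)) -integral_indic//.
    apply: eq_integral => w _; congr EFin; rewrite indicE.
    have [wB|wB] := boolP (w \in _).
      rewrite big1// => i _; rewrite hE indicE mem_set//.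
      by move: wB; rewrite inE => /(_ i); apply; rewrite /= inE.
    apply/eqP/prodf_eq0.
    have /existsNP[i] : ~ (forall i, (Y i @^-1` A i) w).
      by move=> H; move: wB; rewrite notin_setE; apply => i _; exact: H.
    by move=> Hi; exists i => //; rewrite hE indicE memNset//=.
  rewrite indepY//; apply: eq_big => [i|i _]; first by rewrite inE.
  rewrite -[in LHS](setIT (_ @^-1` _)) -integral_indic//.
  by apply: eq_integral => w _; rewrite hE !indicE.
have h01 i x : (0 <= h i x <= 1)%R.
  have [/hg -> //|/hA[A _ ->]] := boolP (i \in j :: s).
  by rewrite indicE ler0n lern1 leq_b1.
have mh i : measurable_fun setT (h i).
  by have [/hg -> //|/hA[A mA ->]] := boolP (i \in j :: s).
have mhY i : measurable_fun setT (h i \o Y i) by exact: measurableT_comp.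
pose W w := (\prod_(i | i != j) h i (Y i w))%R.
have W0 w : (0 <= W w)%R by apply: prodr_ge0 => i _; have /andP[] := h01 i (Y i w).
have mW : measurable_fun setT W.
  rewrite (_ : W = fun w => \prod_(i <- [seq i <- index_enum I | i != j]) h i (Y i w))%R.
    by apply: measurable_prod => i _; exact: mhY.
  by apply/funext => w; rewrite big_filter.
have int_fin i : \int[P]_w (h i (Y i w))%:E \is a fin_num.
  rewrite ge0_fin_numE; last first.
    by apply: integral_ge0 => w _; rewrite lee_fin; have /andP[] := h01 i (Y i w).
  apply: le_lt_trans (_ : \int[P]_w (cst 1) w < +oo).
    apply: ge0_le_integral => //=.
    - by move=> w _; rewrite lee_fin; have /andP[] := h01 i (Y i w).
    - exact/measurable_EFinP/mhY.
    - by move=> w _; rewrite lee_fin; have /andP[] := h01 i (Y i w).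
  rewrite integral_cst// mul1e.
  by rewrite (le_lt_trans (probability_le1 P measurableT))// ltry.
pose c := (\prod_(i | i != j) fine (\int[P]_w (h i (Y i w))%:E))%R.
have c0 : (0 <= c)%R.
  apply: prodr_ge0 => i _; apply/fine_ge0/integral_ge0 => w _.
  by rewrite lee_fin; have /andP[] := h01 i (Y i w).
have cE : c%:E = \prod_(i | i != j) \int[P]_w (h i (Y i w))%:E.
  by rewrite -prodEFin; apply: eq_bigr => i _; rewrite fineK.
(* The induction hypothesis with [\1_A] at index [j] identifies [c] times the law of [Y j] with the
   image under [Y j] of the measure of density [W]; integrating [h j] against both gives the
   step. *)
have WE A : measurable A ->
    mscale (NngNum c0) (distribution P (Y j)) A = \int[P]_(w in Y j @^-1` A) (W w)%:E.
  move=> mA; pose h' i := if i == j then \1_A else h i.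
  have h's i : i \in s -> h' i = g i.
    move=> is_; rewrite /h' ifN ?hg ?inE ?is_ ?orbT//.
    by apply: contraNneq js => <-.
  have h'N i : i \notin s -> exists2 B, measurable B & h' i = \1_B.
    move=> is_; rewrite /h'; case: ifPn => [_|ij]; first by exists A.
    by apply: hA; rewrite inE negb_or ij.
  have h'E i : i != j -> h' i = h i by move=> /negbTE ij; rewrite /h' ij.
  have := ih us h' h's h'N.
  rewrite [RHS](bigD1 j)//= [h' j]/h' eqxx.
  under [in RHS]eq_bigr => i ij do rewrite h'E//.
  rewrite -cE muleC => ihE.
  transitivity (c%:E * \int[P]_w (\1_A (Y j w))%:E).
    rewrite /mscale/= /distribution/= /pushforward/=.
    rewrite -[in LHS](setIT (_ @^-1` _)) -integral_indic//.
    exact: measurable_funPTI.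
  rewrite -ihE [RHS]integral_mkcond; apply: eq_integral => w _.
  rewrite (bigD1 j)//= [h' j]/h' eqxx patchE indicE.
  rewrite (eq_bigr (fun i => h i (Y i w))) => [|i ij]; last by rewrite h'E.
  have -> : (w \in Y j @^-1` A) = (Y j w \in A) by apply/idP/idP; rewrite !inE.
  by case: ifPn => _; rewrite ?mul1r ?mul0r.
have mYj : measurable_fun setT (Y j) by [].
have mhj : measurable_fun setT (EFin \o h j) by exact/measurable_EFinP.
have hj0 y : 0 <= (EFin \o h j) y by rewrite lee_fin; have /andP[] := h01 j y.
have := ge0_integral_weight mYj mW W0 WE mhj hj0.
rewrite ge0_integral_mscale// ge0_integral_distribution// => E.
rewrite (bigD1 j)//= -cE muleC [RHS]E.
by apply: eq_integral => w _; rewrite (bigD1 j)//=.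
Qed.

End expectation_prod.

Lemma aeS d (T : measurableType d) (R : realType)
    (mu : {measure set T -> \bar R}) (A B : T -> Prop) :
  (forall x, A x -> B x) -> {ae mu, forall x, A x} -> {ae mu, forall x, B x}.
Proof.
by move=> AB; apply: filterS => //; exact: (ae_filter_ringOfSetsType mu).
Qed.

Section density.
Local Open Scope ereal_scope.
Context d (T : measurableType d) (R : realType) (P : probability T R).
Variables (X : {RV P >-> R}) (f : R -> R).
Hypothesis Xf : is_density X f.
Notation lambda := (@lebesgue_measure R).

Let mf : measurable_fun setT f. Proof. by case: Xf. Qed.

(** The positive part supplies a weight that is non-negative everywhere, as [ge0_integral_weight]
    demands, while [f] is so only almost everywhere. *)
Let f_ae : ae_eq lambda setT (EFin \o f) (EFin \o (fun x => Num.max (f x) 0%R)).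
Proof.
have [_ f0 _] := Xf; apply: aeS f0 => x fx0 _ /=.
by rewrite max_l.
Qed.

Let mf0 : measurable_fun setT (fun x => Num.max (f x) 0%R).
Proof. exact: measurable_maxr. Qed.

Lemma ge0_integral_density (h : R -> R) :
    measurable_fun setT h -> (forall x, (0 <= h x)%R) ->
  \int[P]_w (h (X w))%:E = \int[lambda]_x (h x * f x)%:E.
Proof.
move=> mh h0.
have mEh : measurable_fun setT (EFin \o h) by exact/measurable_EFinP.
have Eh0 y : 0 <= (EFin \o h) y by rewrite lee_fin.
rewrite -(ge0_integral_distribution X mEh Eh0).
have f0 x : (0 <= Num.max (f x) 0)%R by rewrite le_max lexx orbT.
have nuE A : measurable A -> distribution P X A =
    \int[lambda]_(x in idfun @^-1` A) (Num.max (f x) 0%R)%:E.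
  move=> mA; have [_ _ ->//] := Xf; rewrite preimage_id.
  apply: ae_eq_integral => //; first exact/measurable_EFinP/measurable_funTS.
    exact/measurable_EFinP/measurable_funTS.
  by apply: aeS f_ae => x /(_ I).
have mid : measurable_fun setT (idfun : measurableTypeR R -> R).
  exact: measurable_id.
rewrite (@ge0_integral_weight _ _ (measurableTypeR R) R R lambda
  (distribution P X) idfun _ mid mf0 f0 nuE _ mEh Eh0).
apply: ae_eq_integral => //.
- apply: emeasurable_funM => //; exact/measurable_EFinP.
- exact/measurable_EFinP/measurable_funM.
- by apply: aeS f_ae => x /(_ I)/= [<-] _; rewrite EFinM.
Qed.

(** This is what permits integrating the signed sum [lin_comb_density] term by term. *)
Lemma integrable_density : lambda.-integrable setT (EFin \o f).
Proof.
apply/integrableP; split; first exact/measurable_EFinP.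
have -> : \int[lambda]_x `|(EFin \o f) x| = \int[lambda]_x (f x)%:E.
  apply: ae_eq_integral => //.
  - exact/measurableT_comp/measurable_EFinP.
  - exact/measurable_EFinP.
  - have [_ f0 _] := Xf; apply: aeS f0 => x fx0 _ /=.
    by rewrite ger0_norm.
have [_ _ /(_ setT measurableT) <-] := Xf.
by rewrite probability_setT ltry.
Qed.

End density.

(** * Dilations of Lebesgue measure *)

Section lebesgue_scaling.
Local Open Scope ereal_scope.
Context {R : realType}.
Notation lambda := (@lebesgue_measure R).

Let measurable_scale (a : R) :
  measurable_fun setT (( *%R a) : measurableTypeR R -> measurableTypeR R).
Proof. exact: mulrl_measurable. Qed.

(** The right side is a measure in [A] with the values of Lebesgue measure on half-open intervals,
    hence equal to it by uniqueness. *)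
Lemma lebesgue_measure_scale (a : R) (A : set R) : (0 < a)%R ->
    measurable A ->
  lambda A = a%:E * lambda [set x | A (a * x)%R].
Proof.
move=> a0 mA.
apply: (@lebesgue_measure_unique R
  (mscale (NngNum (ltW a0)) (pushforward lambda
    (( *%R a) : measurableTypeR R -> measurableTypeR R)))) => //.
move=> _ [[b c] _ <-] /=; rewrite /mscale /pushforward/=.
rewrite [X in _ = _ * lambda X](_ : _ = `](b / a)%R, (c / a)%R]%classic); last first.
  apply/seteqP; split => x /=; rewrite !in_itv/=;
    by rewrite ltr_pdivrMr// ler_pdivlMr// ![(x * a)%R]mulrC.
rewrite !lebesgue_measure_itv/= !lte_fin ltr_pM2r ?invr_gt0//.
case: ifPn => _; last by rewrite mule0.
by rewrite -EFinM -mulrBl mulrC divfK ?gt_eqF.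
Qed.

Lemma ge0_integral_scale (a : R) (h : R -> \bar R) : (0 < a)%R ->
    measurable_fun setT h -> (forall x, 0 <= h x) ->
  \int[lambda]_x h x = a%:E * \int[lambda]_x h (a * x)%R.
Proof.
move=> a0 mh h0.
rewrite (@ge0_integral_weight _ _ (measurableTypeR R) (measurableTypeR R) R
  lambda lambda ( *%R a) (cst a) (measurable_scale a) _ _ _ h mh h0)//=.
- under eq_integral do rewrite muleC.
  by rewrite ge0_integralZl_EFin// ?(ltW a0)//; exact: measurableT_comp.
- by move=> _; exact: ltW.
- move=> A mA; rewrite integral_cst; first exact: lebesgue_measure_scale.
  by rewrite -[_ @^-1` _]setTI; exact: measurable_scale.
Qed.

(** Positive and negative parts scale separately; integrability lets the factor [a] be distributed
    over their difference. *)
Lemma integral_scale (a : R) (h : R -> R) : (0 < a)%R ->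
    lambda.-integrable setT (fun x => (h (a * x)%R)%:E) ->
    measurable_fun setT h ->
  lambda.-integrable setT (EFin \o h) /\
  \int[lambda]_x (h x)%:E = a%:E * \int[lambda]_x (h (a * x)%R)%:E.
Proof.
move=> a0 ih mh.
have mEh : measurable_fun setT (EFin \o h) by exact/measurable_EFinP.
split.
  apply/integrableP; split => //.
  rewrite (@ge0_integral_scale a)//; last exact: measurableT_comp.
  by rewrite lte_mul_pinfty ?lee_fin ?(ltW a0)//; have /integrableP[] := ih.
rewrite [LHS]integralE (ge0_integral_scale a0 (measurable_funepos mEh))//.
rewrite (ge0_integral_scale a0 (measurable_funeneg mEh))//.
rewrite [in RHS]integralE.
rewrite (@muleBr R a%:E _ _ isT (integrable_add_def measurableT ih)).
congr (_ * _ - _ * _); apply: eq_integral => x _.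
  by rewrite !funeposE.
by rewrite !funenegE.
Qed.

End lebesgue_scaling.

(** * Laplace transforms *)

(* Truncating at [0] makes the kernel bounded on the whole line; it changes
   nothing for an almost surely non-negative variable. *)
Definition laplace_kernel (R : realType) (t x : R) : R :=
  expR (- (t * Num.max x 0)).

Definition laplace d (T : measurableType d) (R : realType)
    (P : probability T R) (X : {RV P >-> R}) (t : R) : R :=
  \int[P]_w laplace_kernel t (X w).

Section laplace_kernel_theory.
Variable R : realType.
Implicit Types t x a : R.

Lemma laplace_kernel_ge0 t x : 0 <= laplace_kernel t x.
Proof. exact: expR_ge0. Qed.

Lemma laplace_kernel_le1 t x : 0 <= t -> laplace_kernel t x <= 1.
Proof.
by move=> t0; rewrite -expR0 ler_expR oppr_le0 mulr_ge0// le_max lexx orbT.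
Qed.

Lemma measurable_laplace_kernel t : measurable_fun setT (laplace_kernel t).
Proof.
apply: measurableT_comp; first exact: measurable_expR.
apply: measurableT_comp => //.
by apply: measurable_funM => //; exact: measurable_maxr.
Qed.

Lemma laplace_kernelZ t a x : 0 <= a ->
  laplace_kernel t (a * x) = laplace_kernel (a * t) x.
Proof.
move=> a0; rewrite /laplace_kernel -[X in Num.max _ X](mulr0 a) -maxr_pMr//.
by rewrite mulrCA mulrA.
Qed.

End laplace_kernel_theory.

Section laplace_theory.
Local Open Scope ereal_scope.
Context d (T : measurableType d) (R : realType) (P : probability T R).
Variable X : {RV P >-> R}.

Lemma measurable_laplace_kernel_RV t :
  measurable_fun setT (fun w => laplace_kernel t (X w)).
Proof.
by apply: measurableT_comp => //; exact: measurable_laplace_kernel.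
Qed.

(** Taking the finite part loses nothing, as the kernel lies between [0] and [1]. *)
Lemma laplaceE t : (0 <= t)%R ->
  \int[P]_w (laplace_kernel t (X w))%:E = (laplace X t)%:E.
Proof.
move=> t0; rewrite /laplace /Rintegral fineK// ge0_fin_numE; last first.
  by apply: integral_ge0 => w _; rewrite lee_fin laplace_kernel_ge0.
apply: le_lt_trans (_ : \int[P]_w (cst 1) w < +oo).
  apply: ge0_le_integral => //=.
  - by move=> w _; rewrite lee_fin laplace_kernel_ge0.
  - apply/measurable_EFinP; exact: measurable_laplace_kernel_RV.
  - by move=> w _; rewrite lee_fin laplace_kernel_le1.
rewrite integral_cst// mul1e.
by rewrite (le_lt_trans (probability_le1 P measurableT))// ltry.
Qed.

End laplace_theory.

Lemma laplace_copy d (T : measurableType d) (R : realType)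
    (P : probability T R) (X : {RV P >-> R})
    d' (T' : measurableType d') (P' : probability T' R) (Y : {RV P' >-> R}) t :
  (forall A, measurable A -> distribution P' Y A = distribution P X A) ->
  laplace Y t = laplace X t.
Proof.
move=> YX; rewrite /laplace /Rintegral; congr fine.
have mk : measurable_fun setT (EFin \o laplace_kernel t).
  apply/measurable_EFinP; exact: measurable_laplace_kernel.
have k0 y : (0 <= (EFin \o laplace_kernel t) y)%E.
  by rewrite lee_fin laplace_kernel_ge0.
rewrite -(ge0_integral_distribution Y mk k0) -(ge0_integral_distribution X mk k0).
by apply: eq_measure_integral => A mA _; exact: YX.
Qed.

(** * The functional equation for the Laplace transform *)

Section laplace_lin_comb.
Context (R : realType) (n : nat) (mu : 'I_n -> R).
Hypotheses (mu_gt0 : forall i, 0 < mu i).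
Context d (T : measurableType d) (P : probability T R).
Variables (X : {RV P >-> R}) (f : R -> R).
Hypotheses (X_ge0 : {ae P, forall w, 0 <= X w}) (f_density : is_density X f).
Hypothesis f_lt0 : forall x, x < 0 -> f x = 0.
Context d' (T' : measurableType d') (P' : probability T' R).
Variable Xs : 'I_n -> {RV P' >-> R}.
Hypothesis Xs_copies : independent_copies X Xs.
Hypothesis S_density : is_density (lin_comb_RV mu Xs) (lin_comb_density mu f).

(** The mass of the negative half-line depends on the law only, and finitely many null sets have a
    null union. *)
Let Xs_ge0 : {ae P', forall w, forall i, 0 <= Xs i w}.
Proof.
apply: (@filter_forall _ _ (fun i w => 0 <= Xs i w) (almost_everywhere P')
  (ae_filter_ringOfSetsType P')).
move=> i; have [_ copies] := Xs_copies.
have mneg (Y : set R) : measurable Y -> measurable (X @^-1` Y).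
  by move=> mY; apply: measurable_funPTI.
have PX0 : P (X @^-1` `]-oo, 0[%classic) = 0%E.
  apply: measure_negligible; first exact: mneg.
  apply: negligibleS X_ge0 => w /=; rewrite in_itv/= => w0.
  by apply/negP; rewrite -ltNge.
exists (Xs i @^-1` `]-oo, 0[%classic); split.
- exact: measurable_funPTI.
- by rewrite -PX0; exact: copies.
- by move=> w /= /negP; rewrite -ltNge in_itv.
Qed.

Let lin_comb_densityE x :
  lin_comb_density mu f x = \sum_(j < n) ell mu j / mu j * f (x / mu j).
Proof.
rewrite /lin_comb_density; case: leP => // x0; rewrite big1// => j _.
by rewrite f_lt0 ?mulr0// pmulr_llt0 ?invr_gt0.
Qed.

Let laplace_independent t : 0 <= t ->
  (\int[P']_w (laplace_kernel t (lin_comb_RV mu Xs w))%:E =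
   (\prod_(i < n) laplace X (mu i * t))%R%:E)%E.
Proof.
move=> t0; have [indep copies] := Xs_copies.
have t0i i : 0 <= mu i * t by rewrite mulr_ge0// ltW.
transitivity (\int[P']_w (\prod_(i < n) laplace_kernel (mu i * t) (Xs i w))%R%:E)%E.
  apply: ae_eq_integral => //.
  - apply/measurable_EFinP; exact: measurable_laplace_kernel_RV.
  - apply/measurable_EFinP/measurable_prod => i _.
    exact: measurable_laplace_kernel_RV.
  (* Where all [Xs i] are non-negative no truncation takes effect, and the exponential of the sum
     splits. *)
  apply: aeS Xs_ge0 => w Xs0 _; congr EFin.
  rewrite lin_comb_RVE /laplace_kernel -expR_sum; congr expR.
  rewrite max_l; last by apply: sumr_ge0 => i _; rewrite mulr_ge0// ltW.
  rewrite mulr_sumr -sumrN; apply: eq_bigr => i _.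
  by rewrite max_l// mulrCA mulrA.
rewrite (expectation_prod_independent indep (g := fun i => laplace_kernel (mu i * t))).
- rewrite -prodEFin; apply: eq_bigr => i _.
  by rewrite laplaceE// (laplace_copy _ (copies i)).
- by move=> i; exact: measurable_laplace_kernel.
- by move=> i x; rewrite laplace_kernel_ge0 laplace_kernel_le1.
Qed.

Let mf : measurable_fun setT f. Proof. by case: f_density. Qed.

Let laplace_density t : 0 <= t ->
  (\int[P']_w (laplace_kernel t (lin_comb_RV mu Xs w))%:E =
   (\sum_(j < n) ell mu j * laplace X (mu j * t))%R%:E)%E.
Proof.
move=> t0; have t0i i : 0 <= mu i * t by rewrite mulr_ge0// ltW.
rewrite (ge0_integral_density S_density)//; last 2 first.
- exact: measurable_laplace_kernel.
- exact: laplace_kernel_ge0.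
pose g j x := laplace_kernel t x * f (x / mu j).
have mg j : measurable_fun setT (g j).
  apply: measurable_funM; first exact: measurable_laplace_kernel.
  by apply: measurableT_comp => //; exact: mulrr_measurable.
have gE j x : g j (mu j * x) = laplace_kernel (mu j * t) x * f x.
  by rewrite /g laplace_kernelZ ?(ltW (mu_gt0 j))// mulrAC mulfV ?mul1r// gt_eqF.
(* Substituting [mu j * x] for [x] moves the scale from [f] into the kernel; the factor [mu j]
   produced here cancels the denominator in [ell mu j / mu j]. *)
have ig j : lebesgue_measure.-integrable setT (EFin \o g j) /\
    (\int[lebesgue_measure]_x (g j x)%:E = (mu j * laplace X (mu j * t))%R%:E)%E.
  have [|//|i e] := integral_scale (mu_gt0 j) (h := g j).
    apply: le_integrable (integrable_density f_density) => //.
      apply/measurable_EFinP; under eq_fun do rewrite gE.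
      by apply: measurable_funM => //; exact: measurable_laplace_kernel.
    move=> x _; rewrite gE/= lee_fin normrM ger0_norm ?laplace_kernel_ge0//.
    by rewrite ler_piMl// laplace_kernel_le1.
  split => //; rewrite e EFinM; congr (_ * _)%E.
  rewrite -laplaceE// (ge0_integral_density f_density)//.
  - by apply: eq_integral => x _; rewrite gE.
  - exact: measurable_laplace_kernel.
  - exact: laplace_kernel_ge0.
transitivity (\int[lebesgue_measure]_x
    \sum_(j < n) ((ell mu j / mu j)%:E * (g j x)%:E))%E.
  apply: eq_integral => x _.
  rewrite lin_comb_densityE mulr_sumr -sumEFin; apply: eq_bigr => j _.
  by rewrite /g -EFinM mulrCA.
rewrite integral_sum//; last by move=> j; apply: integrableZl => //; case: (ig j).
rewrite -sumEFin; apply: eq_bigr => j _.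
rewrite integralZl//; last by case: (ig j).
by case: (ig j) => _ ->; rewrite -EFinM mulrA divfK// gt_eqF.
Qed.

(** Both sides compute the transform of the linear combination, by independence and from its
    density. *)
Lemma laplace_lin_comb t : 0 <= t ->
  \prod_(i < n) laplace X (mu i * t) =
  \sum_(j < n) ell mu j * laplace X (mu j * t).
Proof. by move=> t0; apply: EFin_inj; rewrite -laplace_independent// laplace_density. Qed.

End laplace_lin_comb.

(** * Moments *)

Section expR_taylor.
Variable R : realType.

(* [(-1) ^+ K] times the remainder of order [K] of [expR (- y)] at [0], in a
   form whose derivative is the remainder of the previous order. *)
Fixpoint expRN_remainder (K : nat) (y : R) : R :=
  if K is K'.+1 then y ^+ K' / K'`!%:R - expRN_remainder K' y
  else expR (- y).

Lemma expRN_remainderE K (y : R) :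
  (-1) ^+ K * expRN_remainder K y =
  expR (- y) - \sum_(i < K) (- y) ^+ i / i`!%:R.
Proof.
elim: K => [|K ih]; first by rewrite big_ord0 subr0 mul1r.
rewrite big_ord_recr/= opprD addrA -ih exprS mulN1r mulNr mulrBr.
by rewrite -[in (- y) ^+ K]mulN1r exprMn; ring.
Qed.

Let is_derive_expRN_remainder K (y : R) :
  is_derive y 1 (expRN_remainder K.+1) (expRN_remainder K y).
Proof.
have d0 : is_derive y 1 (expRN_remainder 0) (- expR (- y)).
  rewrite (_ : expRN_remainder 0 = expR \o -%R)//.
  have := is_derive1_comp (is_derive_expR (- y)) (is_deriveNid y 1).
  by rewrite mulrN1.
elim: K => [|K ih].
  rewrite (_ : expRN_remainder 1 = cst 1 - expRN_remainder 0); last first.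
    by apply/funext => z /=; rewrite fctE /= expr0 fact0 divr1.
  by apply: is_derive_eq; rewrite sub0r opprK.
rewrite (_ : expRN_remainder K.+2 =
  (K.+1`!%:R)^-1 *: (id ^+ K.+1 : R -> R) - expRN_remainder K.+1); last first.
  by apply/funext => z /=; rewrite !fctE /= mulrC.
apply: is_derive_eq; rewrite /=; congr (_ - _).
rewrite scaler1 /GRing.scale/= mulrA mulrC factS natrM.
by field; rewrite nat1r !pnatr_eq0 -lt0n fact_gt0.
Qed.

(** A remainder of positive order vanishes at [0] and has the previous remainder as derivative, so
    it is non-decreasing on the half-line. *)
Lemma expRN_remainder_ge0 K (y : R) : 0 <= y -> 0 <= expRN_remainder K y.
Proof.
elim: K y => [|K ih] y y0; first exact: expR_ge0.
have r0 : expRN_remainder K.+1 0 = 0.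
  elim: K {ih} => [|K ihK]; first by rewrite /= oppr0 expR0 expr0 fact0 divr1 subrr.
  by rewrite [LHS]/= -/(expRN_remainder K.+1 0) ihK expr0n mul0r subrr.
have dr x : derivable (expRN_remainder K.+1) x 1.
  by have [] := is_derive_expRN_remainder K x.
have r'E x : derive1 (expRN_remainder K.+1) x = expRN_remainder K x.
  by rewrite derive1E; have [_ ->] := is_derive_expRN_remainder K x.
rewrite -r0; apply: (@ger0_derive1_ndecry R (expRN_remainder K.+1) 0 _ _ _ 0 y).
- by move=> x _.
- by move=> x; rewrite in_itv/= andbT r'E => /ltW/ih.
- apply: continuous_subspaceT => x; apply: differentiable_continuous.
  exact/derivable1_diffP.
- exact: lexx.
- exact: y0.
Qed.

(** Non-negativity in order [K] settles the absolute value; in order [K.+1] it is the upper bound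
    itself. *)
Lemma expRN_taylor K (y : R) : 0 <= y ->
  `|expR (- y) - \sum_(i < K) (- y) ^+ i / i`!%:R| <= y ^+ K / K`!%:R.
Proof.
move=> y0; rewrite -expRN_remainderE normrM normrX normrN normr1 expr1n mul1r.
rewrite ger0_norm ?expRN_remainder_ge0// -subr_ge0.
exact: (expRN_remainder_ge0 K.+1 y0).
Qed.

End expR_taylor.

Section moments.
Context d (T : measurableType d) (R : realType) (P : probability T R).
Variables (X : {RV P >-> R}) (cramerX : cramer_condition X).

Let Y w : R := Num.max (X w) 0.

Let Y0 w : 0 <= Y w. Proof. by rewrite le_max lexx orbT. Qed.

Let mY : measurable_fun setT Y. Proof. exact: measurable_maxr. Qed.

(** Dividing by the factorial makes this the coefficient of [(- t) ^+ k] in the transform; the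
    truncation matches [laplace_kernel]. *)
Definition moment_coef (k : nat) : R := \int[P]_w (Num.max (X w) 0 ^+ k / k`!%:R).

Let mYk k : measurable_fun setT (fun w => Y w ^+ k / k`!%:R).
Proof. by apply: measurable_funM => //; exact: measurable_funX. Qed.

Lemma integrable_moment k :
  P.-integrable setT (fun w => (Num.max (X w) 0 ^+ k / k`!%:R)%:E).
Proof.
(* A negative argument in Cramér's condition makes [expR (a * X w)] integrable with [a = t0 / 2].
   The dominating function is [a ^- k] times [1 + expR (a * X w)], the [1] covering the points where
   [X w <= 0]. *)
have [t0 t0_gt0 /(_ (- (t0 / 2)))] := cramerX.
have -> : - t0 < - (t0 / 2) < t0 by apply/andP; split; lra.
move=> /(_ isT); set a := t0 / 2; have a0 : 0 < a by rewrite /a; lra.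
rewrite opprK unlock => expX.
have mexp : measurable_fun setT (fun w => expR (a * X w)).
  by apply: measurableT_comp => //; exact: measurable_funM.
have iexp : P.-integrable setT (fun w => (expR (a * X w))%:E).
  apply/integrableP; split; first exact/measurable_EFinP.
  by under eq_integral do rewrite gee0_abs ?lee_fin ?expR_ge0//.
have i1 : P.-integrable setT (EFin \o cst (1 : R)).
  exact: finite_measure_integrable_cst.
have := integrableZl measurableT (a ^- k) (integrableD measurableT i1 iexp).
apply: le_integrable => //; first exact/measurable_EFinP/mYk.
move=> w _; have Yw0 : 0 <= Num.max (X w) 0 := Y0 w.
rewrite /= lee_fin ger0_norm ?divr_ge0 ?exprn_ge0//.
rewrite ger0_norm; last by rewrite mulr_ge0 ?invr_ge0 ?exprn_ge0 
  ?addr_ge0 ?expR_ge0 ?(ltW a0).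
rewrite -ler_pdivrMl ?invr_gt0 ?exprn_gt0// invrK mulrA -exprMn.
apply: le_trans (_ : expR (a * Y w) <= _).
  have aY : 0 <= a * Y w by rewrite mulr_ge0// ltW.
  case: k => [|k]; first by rewrite expr0 fact0 divr1 -expR0 ler_expR.
  by apply: le_trans (expR_ge1Dxn k aY); rewrite ler_wpDl.
rewrite /Y; case: (leP (X w) 0) => _; last by rewrite ler_wpDl.
by rewrite mulr0 expR0 lerDl expR_ge0.
Qed.

Lemma moment_coef0 : moment_coef 0 = 1.
Proof.
rewrite /moment_coef; under eq_Rintegral do rewrite expr0 fact0 divr1.
by rewrite Rintegral_cst// mul1r; exact: (congr1 fine (@probability_setT _ _ _ P)).
Qed.

Lemma laplace_taylor K t : 0 <= t ->
  `|laplace X t - \sum_(i < K) moment_coef i * (- t) ^+ i| <=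
  moment_coef K * t ^+ K.
Proof.
move=> t0.
(* [g K] is the pointwise Taylor remainder; raising [K] subtracts one integrable moment at a
   time. *)
pose g K w := expR (- (t * Y w)) - \sum_(i < K) (- (t * Y w)) ^+ i / i`!%:R.
have [ig gE] : P.-integrable setT (EFin \o g K) /\
    \int[P]_w g K w = laplace X t - \sum_(i < K) moment_coef i * (- t) ^+ i.
  elim: K => [|K [ig gE]].
    have g0E : g 0%N = fun w => laplace_kernel t (X w).
      by apply/funext => w; rewrite /g big_ord0 subr0.
    rewrite g0E big_ord0 subr0; split => //.
    apply: le_integrable (finite_measure_integrable_cst P 1 measurableT) => //.
      by apply/measurable_EFinP; exact: measurable_laplace_kernel_RV.
    move=> w _; rewrite /= lee_fin normr1 ger0_norm ?laplace_kernel_ge0//.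
    exact: laplace_kernel_le1.
  have im := integrableZl measurableT ((- t) ^+ K) (integrable_moment K).
  have gS : g K.+1 = fun w => g K w - (- t) ^+ K * (Y w ^+ K / K`!%:R).
    apply/funext => w; rewrite /g big_ord_recr/= opprD addrA; congr (_ - _).
    by rewrite -mulNr exprMn mulrA.
  rewrite gS; split.
    by have := integrableB measurableT ig im; apply: eq_integrable.
  rewrite RintegralB// gE RintegralZl//; last exact: integrable_moment.
  by rewrite big_ord_recr/= opprD addrA [X in _ = _ - X]mulrC.
rewrite -gE; apply: le_trans (le_normr_Rintegral measurableT ig) _.
have := RintegralZr (t ^+ K) measurableT (integrable_moment K).
rewrite -/(moment_coef K) => <-.
apply: le_Rintegral => //.
- exact: integrable_norm.
- have := integrableZr measurableT (t ^+ K) (integrable_moment K).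
  by apply: eq_integrable.
- move=> w _; apply: le_trans (expRN_taylor _ _) _; first by rewrite mulr_ge0.
  by rewrite exprMn -mulrA mulrC.
Qed.

End moments.

(** * Laplace transforms determine laws *)

Lemma bernoulli_inequality (R : realDomainType) (v : R) (M : nat) :
  -1 <= v -> 1 + M%:R * v <= (1 + v) ^+ M.
Proof.
move=> v1; have v0 : 0 <= 1 + v by rewrite -lerBlDl sub0r.
elim: M => [|M ih]; first by rewrite mul0r addr0 expr0.
rewrite exprS; apply: le_trans (ler_wpM2l v0 ih).
have : 0 <= M%:R * v ^+ 2 by rewrite mulr_ge0 ?ler0n ?sqr_ge0.
by rewrite -natr1; lra.
Qed.

(** Bernoulli's inequality gives the lower bound [1 - (2 * u) ^+ N]. *)
Lemma cvg_steep_lt (R : realType) (u : R) : 0 <= u < 2^-1 ->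
  (1 - u ^+ N) ^+ (2 ^ N) @[N --> \oo] --> (1 : R).
Proof.
move=> /andP[u0 u2].
have y1 : `|2 * u| < 1 by rewrite ger0_norm ?mulr_ge0//; lra.
have uN N : 0 <= u ^+ N <= 1 by rewrite exprn_ge0// exprn_ile1//; lra.
apply: (@squeeze_cvgr _ _ _ _ (fun N => 1 - (2 * u) ^+ N) (cst 1)).
- near=> N; apply/andP; split; last first.
    by have /andP[a b] := uN N; rewrite exprn_ile1//; lra.
  have /andP[a b] := uN N.
  have := @bernoulli_inequality R (- u ^+ N) (2 ^ N) _.
  rewrite lerN2 => /(_ b); apply: le_trans.
  by rewrite natrX mulrN -exprMn.
- rewrite -[X in _ --> X]subr0; apply: cvgB; first exact: cvg_cst.
  exact: cvg_expr.
- exact: cvg_cst.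
Unshelve. all: by end_near. Qed.

(** With [v = u ^+ N] and [M = 2 ^ N], the product of [(1 - v) ^+ M] and [(1 + v) ^+ M] is at most
    [1], and by Bernoulli the second factor is at least [(2 * u) ^+ N]. *)
Lemma cvg_steep_gt (R : realType) (u : R) : 2^-1 < u <= 1 ->
  (1 - u ^+ N) ^+ (2 ^ N) @[N --> \oo] --> (0 : R).
Proof.
move=> /andP[u2 u1]; have u0 : 0 < u by lra.
have y0 : 0 < 2 * u by lra.
have y1 : `|(2 * u)^-1| < 1.
  by rewrite gtr0_norm ?invr_gt0// invf_lt1//; lra.
have uN N : 0 <= u ^+ N <= 1 by rewrite exprn_ge0 ?exprn_ile1// ltW.
apply: (@squeeze_cvgr _ _ _ _ (cst 0) (fun N => ((2 * u)^-1) ^+ N)).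
- near=> N; have /andP[a b] := uN N.
  have v0 : 0 <= 1 - u ^+ N by lra.
  rewrite exprn_ge0//= exprVn -[leRHS]mul1r ler_pdivlMr ?exprn_gt0//.
  apply: (@le_trans _ _ ((1 - u ^+ N) ^+ (2 ^ N) * (1 + u ^+ N) ^+ (2 ^ N))).
    apply: ler_wpM2l; first exact: exprn_ge0.
    have v1 : -1 <= u ^+ N by lra.
    apply: le_trans (bernoulli_inequality (2 ^ N) v1).
    by rewrite natrX exprMn lerDr.
  rewrite -exprMn exprn_ile1//; first by rewrite mulr_ge0//; lra.
  by rewrite -subr_sqr expr1n lerBlDr lerDl sqr_ge0.
- exact: cvg_cst.
- exact: cvg_expr.
Unshelve. all: by end_near. Qed.

Lemma laplace_kernelD (R : realType) (s t x : R) :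
  laplace_kernel s x * laplace_kernel t x = laplace_kernel (s + t) x.
Proof. by rewrite /laplace_kernel -expRD -opprD -mulrDl. Qed.

Lemma laplace_kernelMn (R : realType) (t x : R) (N : nat) :
  laplace_kernel (N%:R * t) x = laplace_kernel t x ^+ N.
Proof. by rewrite /laplace_kernel -expRM_natl mulrN mulrA. Qed.

Lemma laplace_kernel0 (R : realType) (x : R) : laplace_kernel 0 x = 1.
Proof. by rewrite /laplace_kernel mul0r oppr0 expR0. Qed.

Section laplace_determines.
Local Open Scope ereal_scope.
Variable R : realType.
Implicit Types m : probability R R.

Let integrable_bounded m (h : R -> R) : measurable_fun setT h ->
  (forall x, 0 <= h x <= 1)%R -> m.-integrable setT (EFin \o h).
Proof.
move=> mh h01.
apply: le_integrable (finite_measure_integrable_cst m 1 measurableT) => //.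
  exact/measurable_EFinP.
move=> x _; have /andP[h0 h1] := h01 x.
by rewrite /= lee_fin normr1 ger0_norm.
Qed.

Let kernel_pow01 (s t x : R) M : (0 <= s -> 0 <= t ->
  0 <= laplace_kernel t x * (1 - laplace_kernel s x) ^+ M <= 1)%R.
Proof.
move=> s0 t0; have k0 := laplace_kernel_ge0 s x; have k1 := laplace_kernel_le1 x s0.
have e0 : (0 <= 1 - laplace_kernel s x)%R by rewrite subr_ge0.
rewrite mulr_ge0 ?laplace_kernel_ge0 ?exprn_ge0//=.
rewrite mulr_ile1 ?laplace_kernel_ge0 ?exprn_ge0 ?laplace_kernel_le1//.
by rewrite exprn_ile1// lerBlDr lerDl.
Qed.

Let measurable_kernel_pow (s t : R) M :
  measurable_fun setT (fun x : R => laplace_kernel t x * (1 - laplace_kernel s x) ^+ M)%R.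
Proof.
apply: measurable_funM; first exact: measurable_laplace_kernel.
apply: measurable_funX; apply: measurable_funB => //.
exact: measurable_laplace_kernel.
Qed.

(** Expanding the power yields a combination of kernels. The factor [laplace_kernel t] carries the
    induction, each step shifting [t] to [t + s]. *)
Let eq_integral_kernel_pow m1 m2 (s t : R) M :
    (0 <= s)%R -> (0 <= t)%R ->
    (forall t, (0 <= t)%R -> \int[m1]_x (laplace_kernel t x)%:E =
                             \int[m2]_x (laplace_kernel t x)%:E) ->
  \int[m1]_x (laplace_kernel t x * (1 - laplace_kernel s x) ^+ M)%:E =
  \int[m2]_x (laplace_kernel t x * (1 - laplace_kernel s x) ^+ M)%:E.
Proof.
move=> s0 + eqm; elim: M t => [|M ih] t t0.
  under eq_integral do rewrite expr0 mulr1.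
  by under [RHS]eq_integral do rewrite expr0 mulr1; exact: eqm.
have E m : \int[m]_x (laplace_kernel t x * (1 - laplace_kernel s x) ^+ M.+1)%:E =
    \int[m]_x (laplace_kernel t x * (1 - laplace_kernel s x) ^+ M)%:E -
    \int[m]_x (laplace_kernel (t + s) x * (1 - laplace_kernel s x) ^+ M)%:E.
  rewrite -integralB_EFin//; last 2 first.
  - apply: integrable_bounded => // x; exact: kernel_pow01.
  - apply: integrable_bounded => // x; apply: kernel_pow01 => //; exact: addr_ge0.
  apply: eq_integral => x _; rewrite -EFinB; congr EFin.
  by rewrite -laplace_kernelD exprS; ring.
by rewrite !E !ih// addr_ge0.
Qed.

(** For [x >= 0] the kernel at [ln 2 / a] is [2^(-x/a)], which crosses the threshold [2^-1] exactly
    at [x = a]; dominated convergence then yields the indicator of the ray. *)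
Let cvg_integral_kernel_pow m (a : R) : (0 < a)%R -> m [set a] = 0 ->
  \int[m]_x ((1 - laplace_kernel (ln 2 / a) x ^+ N) ^+ (2 ^ N))%:E
    @[N --> \oo] --> m `]a, +oo[%classic.
Proof.
move=> a0 ma; set e := (ln 2 / a)%R.
have e0 : (0 < e)%R by rewrite divr_gt0// ln_gt0// ltr1n.
have q01 N x : (0 <= (1 - laplace_kernel e x ^+ N) ^+ (2 ^ N) <= 1)%R.
  have := @kernel_pow01 (N%:R * e)%R 0%R x (2 ^ N).
  rewrite laplace_kernelMn laplace_kernel0 mul1r; apply => //.
  by rewrite mulr_ge0// ltW.
have mq N : measurable_fun setT (fun x => (1 - laplace_kernel e x ^+ N) ^+ (2 ^ N))%R.
  apply: measurable_funX; apply: measurable_funB => //; apply: measurable_funX.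
  exact: measurable_laplace_kernel.
rewrite (_ : m _ = \int[m]_x (\1_(`]a, +oo[%classic) x)%:E); last first.
  by rewrite integral_indic// setIT.
have [||||| _ _ //] := @dominated_convergence _ _ _ m setT measurableT
  (fun N x => ((1 - laplace_kernel e x ^+ N) ^+ (2 ^ N))%:E)
  (fun x => (\1_(`]a, +oo[%classic) x)%:E) (cst 1).
- by move=> N; exact/measurable_EFinP.
- exact/measurable_EFinP.
(* At [x = a] the powers tend to [exp(-1)], so this point has to be a null set. *)
- exists [set a]; split => // x /= nx; apply: contrapT => xa; apply: nx => _.
  have {}xa : x != a by apply/eqP.
  rewrite /laplace_kernel.
  apply/fine_cvgP; split; first exact: nearW.
  have [ax|xa'|xa'] := ltgtP a x; last by rewrite xa' eqxx in xa.
  + rewrite indicE mem_set/= ?in_itv/= ?ax//.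
    have u2 : (0 <= expR (- (e * Num.max x 0)) < 2^-1)%R.
      rewrite expR_ge0/= max_l; last by rewrite ltW// (lt_trans a0).
      rewrite -[ltRHS]lnK ?posrE ?invr_gt0// ltr_expR lnV ?posrE// ltrN2.
      by rewrite /e mulrAC ltr_pdivlMr// ltr_pM2l// ln_gt0// ltr1n.
    exact: (cvg_steep_lt u2).
  + rewrite indicE memNset/=;
      last by rewrite in_itv/= andbT; apply/negP; rewrite -leNgt ltW.
    have u2 : (2^-1 < expR (- (e * Num.max x 0)) <= 1)%R.
      apply/andP; split.
        rewrite -[ltLHS]lnK ?posrE ?invr_gt0// ltr_expR lnV ?posrE// ltrN2.
        rewrite /e mulrAC ltr_pdivrMr// ltr_pM2l ?ln_gt0 ?ltr1n//.
        by rewrite gt_max xa'.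
      by rewrite expR_le1 oppr_le0 mulr_ge0 ?(ltW e0)// le_max lexx orbT.
    exact: (cvg_steep_gt u2).
- exact: finite_measure_integrable_cst.
- apply: aeW => x n _ /=; have /andP[q0 q1] := q01 n x.
  by rewrite lee_fin ger0_norm.
Qed.

Lemma laplace_determines m1 m2 :
    m1 `]-oo, 0%R]%classic = 0 -> m2 `]-oo, 0%R]%classic = 0 ->
    (forall a, m1 [set a] = 0) -> (forall a, m2 [set a] = 0) ->
    (forall t, (0 <= t)%R -> \int[m1]_x (laplace_kernel t x)%:E =
                             \int[m2]_x (laplace_kernel t x)%:E) ->
  forall A, measurable A -> m1 A = m2 A.
Proof.
move=> m1N m2N m1a m2a eqm.
have ray0 m (a : R) : m `]-oo, 0%R]%classic = 0 -> (a <= 0)%R ->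
    m `]a, +oo[%classic = 1.
  move=> mN a0; have mNa : m `]-oo, a]%classic = 0.
    apply/eqP; rewrite eq_le measure_ge0 andbT -mN le_measure ?inE//.
    by apply: subset_itvl; rewrite bnd_simp.
  by rewrite -setCitvl probability_setC// mNa sube0.
(* Open right rays generate the Borel sets and are stable under intersection. Those starting at or
   below [0] have mass [1] for both laws. *)
apply: (measure_unique [set A | exists a : R, A = `]a, +oo[%classic]
  (fun n => `](- n%:R)%R, +oo[%classic)).
- exact: RGenOInfty.measurableE.
- move=> _ _ [a ->] [b ->]; exists (Num.max a b).
  apply/seteqP; split => x /=; rewrite !in_itv/= !andbT gt_max.
    by move=> [-> ->].
  by move=> /andP[].
- by move=> n; eexists.
- apply/seteqP; split => // x _; exists (Num.truncn `|x|%R).+1 => //=.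
  rewrite in_itv/= andbT ltrNl (le_lt_trans _ (Num.Theory.truncnS_gt _))//.
  by rewrite -normrN ler_norm.
- move=> _ [a ->]; have [a0|a0] := leP a 0%R.
    exact: etrans (ray0 m1 a m1N a0) (esym (ray0 m2 a m2N a0)).
  have c1 := cvg_integral_kernel_pow a0 (m1a a).
  have c2 := cvg_integral_kernel_pow a0 (m2a a).
  have e0 : (0 <= ln 2 / a)%R by rewrite divr_ge0 ?(ltW a0)// ln_ge0// ler1n.
  pose I m N := \int[m]_x ((1 - laplace_kernel (ln 2 / a) x ^+ N) ^+ (2 ^ N))%:E.
  have IE : I m1 = I m2.
    apply/funext => N.
    (* The [N]-th integrand is the kernel power with [s = N ln 2 / a], [t = 0] and exponent
       [2 ^ N]. *)
    have e0N : (0 <= N%:R * (ln 2 / a))%R by rewrite mulr_ge0.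
    have := eq_integral_kernel_pow (2 ^ N) e0N (lexx 0%R) eqm.
    under eq_integral do rewrite laplace_kernelMn laplace_kernel0 mul1r.
    by under [in X in _ = X -> _]eq_integral do
      rewrite laplace_kernelMn laplace_kernel0 mul1r.
  have {}c1 : I m1 N @[N --> \oo] --> m1 `]a, +oo[%classic by exact: c1.
  rewrite IE in c1; exact: (cvg_unique _ c1 c2).
- by move=> k; rewrite (le_lt_trans (probability_le1 m1 _))// ltry.
Qed.

End laplace_determines.

(** * Identification of the exponential law *)

Lemma integral_le0_eq0 (R : realType) (f : R -> R) : measurable_fun setT f ->
  (forall x, x < 0 -> f x = 0) ->
  (\int[lebesgue_measure]_(x in `]-oo, 0%R]) (f x)%:E = 0)%E.
Proof.
move=> mf f0.
(* The value of [f] at [0] is unknown, so the closed endpoint is removed first. *)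
rewrite -integral_itv_bndo_bndc; last exact/measurable_EFinP/measurable_funTS.
apply: integral0_eq => x; rewrite /= in_itv/= => x0.
by rewrite f0.
Qed.

(** The integrand is [rate / (rate + t)] times the exponential density of rate [rate + t], whose
    integral is [1]. *)
Lemma laplace_exponential (R : realType) (rate t : R) : 0 < rate -> 0 <= t ->
  (\int[lebesgue_measure]_x (laplace_kernel t x * exponential_pdf rate x)%:E =
   (rate / (rate + t))%:E)%E.
Proof.
move=> r0 t0; have rt0 : 0 < rate + t by rewrite ltr_pwDl.
rewrite -[RHS]mule1 -(integral_exponential_pdf rt0) -ge0_integralZl_EFin//.
- apply: eq_integral => x _; rewrite -EFinM; congr EFin.
  have [x0|x0] := ltP x 0; first by rewrite !lt0_exponential_pdf// !mulr0.
  rewrite !exponential_pdfE// /laplace_kernel max_l//.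
  rewrite mulrCA -expRD [RHS]mulrA divfK ?gt_eqF//.
  by congr (_ * expR _); ring.
- by move=> x _; rewrite lee_fin exponential_pdf_ge0// ltW.
- by apply/measurable_EFinP; exact: measurable_exponential_pdf.
- by rewrite divr_ge0 ?ltW.
Qed.

Lemma exponential_of_laplace d (T : measurableType d) (R : realType)
    (P : probability T R) (X : {RV P >-> R}) (f : R -> R) (rate : R) :
    0 < rate -> is_density X f -> (forall x, x < 0 -> f x = 0) ->
    (forall t, 0 <= t -> laplace X t = rate / (rate + t)) ->
  exponentially_distributed X rate.
Proof.
move=> r0 Xf f0 lapX; have [mf f_ge0 Xd] := Xf.
have mpdf := measurable_exponential_pdf rate.
(* [exponential_prob] is taken on [measurableTypeR R]; its image under the identity is a probability
   on [R], as [laplace_determines] expects. *)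
have [Q QE] : exists Q : probability R R,
    forall A, Q A = exponential_prob rate A.
  have Q : exists Q : probability (measurableTypeR R) R,
      forall A, Q A = exponential_prob rate A.
    unshelve eexists.
      by unshelve refine [the probability _ _ of exponential_prob rate].
    by [].
  have [Q0 Q0E] := Q.
  pose Z : {mfun measurableTypeR R >-> R} := HB.pack
    (idfun : measurableTypeR R -> R)
    (isMeasurableFun.Build _ _ (measurableTypeR R) R idfun (@measurable_id _ R setT)).
  by exists (distribution Q0 Z) => A; exact: Q0E.
have XQ : forall A, measurable A -> distribution P X A = Q A.
  apply: laplace_determines.
  - by apply: etrans (Xd _ _) _ => //; exact: integral_le0_eq0.
  - apply: etrans (QE _) _; apply: integral_le0_eq0 => // x; exact: lt0_exponential_pdf.
  - by move=> a; apply: etrans (Xd _ _) _ => //; exact: integral_set1.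
  - by move=> a; apply: etrans (QE _) _; exact: integral_set1.
  - move=> t t0.
    have mK : measurable_fun setT (EFin \o laplace_kernel t).
      by apply/measurable_EFinP; exact: measurable_laplace_kernel.
    have K0 y : (0 <= (EFin \o laplace_kernel t) y)%E.
      by rewrite lee_fin laplace_kernel_ge0.
    have := ge0_integral_distribution X mK K0; rewrite /comp => ->.
    rewrite laplaceE// lapX// -laplace_exponential//.
    have mid : measurable_fun setT (idfun : measurableTypeR R -> R).
      exact: measurable_id.
    have pdf0 x : 0 <= exponential_pdf rate x by rewrite exponential_pdf_ge0// ltW.
    have := @ge0_integral_weight _ _ (measurableTypeR R) R R lebesgue_measure Q
      idfun _ mid mpdf pdf0 (fun A _ => QE A) _ mK K0.
    by under [in X in _ = X -> _]eq_integral do rewrite -EFinM.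
split => //.
- by apply: aeW => x; rewrite exponential_pdf_ge0// ltW.
- by move=> A mA; rewrite XQ//; exact: QE.
Qed.

(** If the mean of the truncated variable were zero, [X <= 0] would hold almost surely, an event of
    probability zero. *)
Lemma moment_coef1_gt0 d (T : measurableType d) (R : realType)
    (P : probability T R) (X : {RV P >-> R}) :
    cramer_condition X -> distribution P X `]-oo, 0%R]%classic = 0%E ->
  0 < moment_coef X 1.
Proof.
move=> cX X0.
have c0 : 0 <= moment_coef X 1.
  by apply: Rintegral_ge0 => w _; rewrite divr_ge0 ?exprn_ge0// le_max lexx orbT.
rewrite lt_def c0 andbT; apply/negP => /eqP c1.
have i1 := integrable_moment cX 1.
have : (\int[P]_w `|(Num.max (X w) 0 ^+ 1 / 1`!%:R)%:E| = 0)%E.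
  under eq_integral do rewrite gee0_abs ?lee_fin ?divr_ge0 ?exprn_ge0 ?le_max ?lexx ?orbT//.
  by rewrite -[LHS]fineK ?(integrable_fin_num _ i1)//; congr EFin.
move=> /(ae_eq_integral_abs P measurableT (measurable_int _ i1)) ae0.
have : {ae P, forall w, w \in X @^-1` `]-oo, 0%R]%classic}.
  apply: aeS ae0 => w /(_ I)/eqP; rewrite /= expr1 factS fact0 muln1 divr1 eqe => /eqP w0.
  by rewrite inE/= in_itv/= -w0 le_max lexx.
have mA : measurable (X @^-1` `]-oo, 0%R]%classic) by exact: measurable_funPTI.
have XC : P (~` (X @^-1` `]-oo, 0%R]%classic)) = 1%E.
  by rewrite probability_setC// [P _]X0 sube0.
move=> neg; have : P (~` (X @^-1` `]-oo, 0%R]%classic)) = 0%E.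
  apply: measure_negligible; first exact: measurableC.
  by apply: negligibleS neg => w /= Xw; rewrite inE.
by rewrite XC => /eqP; rewrite onee_eq0.
Qed.

Theorem theorem1 (R : realType)
    (n : nat) (hn : (2 <= n)%N)
    (mu : 'I_n -> R) (mu_gt0 : forall i, 0 < mu i) (mu_inj : injective mu)
    (d : measure_display) (T : measurableType d) (P : probability T R)
    (X : {RV P >-> R}) (f : R -> R)
    (X_ge0 : {ae P, forall w, 0 <= X w})
    (f_density : is_density X f)
    (f_lt0 : forall x : R, x < 0 -> f x = 0)
    (X_cramer : cramer_condition X)
    (d' : measure_display) (T' : measurableType d') (P' : probability T' R)
    (Xs : 'I_n -> {RV P' >-> R})
    (Xs_copies : independent_copies X Xs)
    (S_density : is_density (lin_comb_RV mu Xs) (lin_comb_density mu f)) :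
  exists2 lambda : R, 0 < lambda & exponentially_distributed X lambda.
Proof.
have [mf _ Xd] := f_density.
have c1 : 0 < moment_coef X 1.
  by apply: moment_coef1_gt0 => //; rewrite Xd//; exact: integral_le0_eq0.
have szI : (1 < size (index_enum 'I_n))%N.
  rewrite -(card_uniqP (index_enum_uniq _)) (eq_card (B := predT)) ?card_ord//.
  by move=> i; rewrite mem_index_enum.
(* With [m] the mean, [1 / (1 + m t)] is [rate / (rate + t)] for [rate = 1 / m]. *)
exists ((moment_coef X 1)^-1); first by rewrite invr_gt0.
apply: (exponential_of_laplace (f := f)) => //; first by rewrite invr_gt0.
move=> t t0.
rewrite (laplace_rigidity mu_inj mu_gt0 (index_enum_uniq _) szI (moment_coef0 X)
  c1 (laplace_taylor X_cramer) _ t0).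
  by field; rewrite !gt_eqF//= ltr_pwDl// mulr_ge0// ltW.
by move=> u u0; exact: (laplace_lin_comb mu_gt0 X_ge0 f_density f_lt0 Xs_copies S_density).
Qed.
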